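(* Let $(X,d,\ll,\le,\tau)$ be a regularly localizable Lorentzian pre-length space and let $\gamma:[a,b]\to X$ be a future-directed causal curve with $L_\tau(\gamma)>0$. If $\gamma|_{[c,d]}$ is null on some non-trivial subinterval $[c,d]\subseteq[a,b]$, then there exists a future-directed timelike curve $\sigma$ from $\gamma(a)$ to $\gamma(b)$ with $L_\tau(\sigma)>L_\tau(\gamma)$. If $X$ is even SR-localizable, then $\sigma$ can be chosen to lie in any given neighborhood of $\gamma([a,b])$.
   Context: A causal space $(X,\ll,\le)$: $\le$ reflexive and transitive, $\ll$ transitive, $x\ll y\Rightarrow x\le y$; $x<y$ means $x\le y,x\ne y$; $I^\pm$ chronological future/past. A Lorentzian pre-length space $(X,d,\ll,\le,\tau)$ is a causal space with a metric $d$ and $\tau:X\times X\to[0,\infty]$ lower semicontinuous w.r.t. $d$, with $\tau(x,z)\ge\tau(x,y)+\tau(y,z)$ for $x\le y\le z$, $\tau(x,y)=0$ if $x\not\le y$, and $\tau(x,y)>0\iff x\ll y$. Future-directed causal (timelike) curve: non-constant, $d$-locally Lipschitz $\gamma:I\to X$ with $\gamma(t_1)\le\gamma(t_2)$ (resp. $\ll$) for $t_1<t_2$; null if no two of its points are $\ll$-related; a curve contains a null segment if its restriction to a non-trivial subinterval is null. $L_\tau(\gamma)=\inf\sum_i\tau(\gamma(t_i),\gamma(t_{i+1}))$ over partitions $a=t_0<\dots<t_N=b$. $L^d$ is $d$-arclength. For an open set $\Omega$ around $x$ consider the properties: (a) some $C>0$ bounds $L^d$ of every causal curve in $\Omega$;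 (b) there is a continuous $\omega:\Omega\times\Omega\to[0,\infty)$ making $\Omega$ with restricted $d,\ll,\le$ a Lorentzian pre-length space, with $I^\pm(y)\cap\Omega\ne\emptyset$ for all $y\in\Omega$; (c) for $p<q$ in $\Omega$ there is a future-directed causal curve $\gamma_{p,q}$ from $p$ to $q$ in $\Omega$ with $L_\tau(\gamma_{p,q})\ge L_\tau(\lambda)$ for all future-directed causal $\lambda$ from $p$ to $q$ in $\Omega$ and $L_\tau(\gamma_{p,q})=\omega(p,q)\le\tau(p,q)$; (d) whenever $p\ll q$ in $\Omega$, $\gamma_{p,q}$ is timelike and strictly longer than any future-directed causal curve in $\Omega$ from $p$ to $q$ containing a null segment. $X$ is regularly localizable if every point has an open neighborhood with (a)–(d), and SR-localizable if every point has a neighborhood basis of open sets with (a)–(d). *)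

(* Defs.v *)
From HB Require Import structures.
From mathcomp Require Import all_boot all_order all_algebra.
From mathcomp Require Import boolp classical_sets reals constructive_ereal ereal.
Set Implicit Arguments. Unset Strict Implicit. Unset Printing Implicit Defensive.
Import Order.TTheory GRing.Theory Num.Theory.
Local Open Scope classical_set_scope.
Local Open Scope ring_scope.

Section Lorentzian.
Variables (R : realType) (X : Type).

Definition is_metric (d : X -> X -> R) : Prop :=
  [/\ (forall x y, 0 <= d x y),
      (forall x y, d x y = 0 <-> x = y),
      (forall x y, d x y = d y x) &
      (forall x y z, d x z <= d x y + d y z)].

Definition d_open (d : X -> X -> R) (U : set X) : Prop :=
  forall x, U x -> exists2 e : R, 0 < e & forall y, d x y < e -> U y.

Definition d_nbhd_of_set (d : X -> X -> R) (K N : set X) : Prop :=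
  exists U : set X, [/\ d_open d U, K `<=` U & U `<=` N].

(* Lorentzian pre-length space axioms, relativized to a subset S of X
   (S = setT gives the usual notion; a subset S carries the restricted
   d, <<, <=). tau takes values in [0, +oo]. *)
Definition is_LPLS_on (S : set X) (d : X -> X -> R) (ll le : X -> X -> Prop)
  (tau : X -> X -> \bar R) : Prop :=
  (forall x, S x -> le x x) /\
      (forall x y z, S x -> S y -> S z -> le x y -> le y z -> le x z) /\
      (forall x y z, S x -> S y -> S z -> ll x y -> ll y z -> ll x z) /\
      (forall x y, S x -> S y -> ll x y -> le x y) /\
      (forall x y, S x -> S y -> (0 <= tau x y)%E) /\
      (forall x y, S x -> S y -> forall r : R, (r%:E < tau x y)%E ->
         exists2 delta : R, 0 < delta & forall x' y', S x' -> S y' ->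
           d x x' < delta -> d y y' < delta -> (r%:E < tau x' y')%E) /\
      (forall x y z, S x -> S y -> S z -> le x y -> le y z ->
         (tau x y + tau y z <= tau x z)%E) /\
      (forall x y, S x -> S y -> ~ le x y -> tau x y = 0%E) /\
      (forall x y, S x -> S y -> ((0 < tau x y)%E <-> ll x y)).

Definition is_LPLS d ll le tau := is_LPLS_on setT d ll le tau.

Definition itv (a b t : R) : Prop := a <= t /\ t <= b.

Definition loc_lipschitz (d : X -> X -> R) (g : R -> X) (a b : R) : Prop :=
  forall t, itv a b t -> exists2 e : R, 0 < e & exists L : R,
    forall s s', itv a b s -> itv a b s' -> `|s - t| < e -> `|s' - t| < e ->
      d (g s) (g s') <= L * `|s - s'|.

Definition fd_causal (d : X -> X -> R) (le : X -> X -> Prop)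
  (g : R -> X) (a b : R) : Prop :=
  [/\ a < b, loc_lipschitz d g a b,
      (exists s t, [/\ itv a b s, itv a b t & g s <> g t]) &
      (forall t1 t2, itv a b t1 -> itv a b t2 -> t1 < t2 -> le (g t1) (g t2))].

Definition fd_timelike (d : X -> X -> R) (ll : X -> X -> Prop)
  (g : R -> X) (a b : R) : Prop :=
  [/\ a < b, loc_lipschitz d g a b,
      (exists s t, [/\ itv a b s, itv a b t & g s <> g t]) &
      (forall t1 t2, itv a b t1 -> itv a b t2 -> t1 < t2 -> ll (g t1) (g t2))].

Definition null_on (ll : X -> X -> Prop) (g : R -> X) (a b : R) : Prop :=
  forall s t, itv a b s -> itv a b t -> ~ ll (g s) (g t).

Definition null_segment d ll le (g : R -> X) (c e : R) : Prop :=
  fd_causal d le g c e /\ null_on ll g c e.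

Definition has_null_segment d ll le (g : R -> X) (a b : R) : Prop :=
  exists c e, [/\ a <= c, c < e, e <= b & null_segment d ll le g c e].

Definition partition (a b : R) (N : nat) (t : nat -> R) : Prop :=
  [/\ (0 < N)%N, t 0%N = a, t N = b & forall i, (i < N)%N -> t i < t i.+1].

Definition Ltau (tau : X -> X -> \bar R) (g : R -> X) (a b : R) : \bar R :=
  ereal_inf [set s | exists N t, partition a b N t /\
     s = (\sum_(i < N) tau (g (t i)) (g (t i.+1)))%E].

Definition Ld (d : X -> X -> R) (g : R -> X) (a b : R) : \bar R :=
  ereal_sup [set s | exists N t, partition a b N t /\
     s = (\sum_(i < N) (d (g (t i)) (g (t i.+1)))%:E)%E].

Definition curve_in (U : set X) (g : R -> X) (a b : R) : Prop :=
  forall t, itv a b t -> U (g t).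

Definition localizing_nbhd d (ll le : X -> X -> Prop) (tau : X -> X -> \bar R)
  (Omega : set X) : Prop :=
  (exists2 C : R, 0 < C & forall g a b, fd_causal d le g a b ->
      curve_in Omega g a b -> (Ld d g a b <= C%:E)%E) /\
  exists omega : X -> X -> R,
  [/\ (forall p q, Omega p -> Omega q -> 0 <= omega p q),
      (forall p q, Omega p -> Omega q -> forall e : R, 0 < e ->
         exists2 delta : R, 0 < delta & forall p' q', Omega p' -> Omega q' ->
           d p p' < delta -> d q q' < delta -> `|omega p' q' - omega p q| < e),
      is_LPLS_on Omega d ll le (fun p q => (omega p q)%:E),
      (forall y, Omega y -> (exists z, Omega z /\ ll y z) /\
                            (exists z, Omega z /\ ll z y)) &
      (forall p q, Omega p -> Omega q -> le p q -> p <> q ->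
        exists g a b,
          fd_causal d le g a b /\ g a = p /\ g b = q /\ curve_in Omega g a b /\
              (forall l a' b', fd_causal d le l a' b' -> l a' = p -> l b' = q ->
                 curve_in Omega l a' b' -> (Ltau tau l a' b' <= Ltau tau g a b)%E) /\
              Ltau tau g a b = (omega p q)%:E /\ ((omega p q)%:E <= tau p q)%E /\
              (ll p q ->
                 fd_timelike d ll g a b /\
                 (forall l a' b', fd_causal d le l a' b' -> l a' = p -> l b' = q ->
                    curve_in Omega l a' b' -> has_null_segment d ll le l a' b' ->
                    (Ltau tau l a' b' < Ltau tau g a b)%E)))].

Definition regularly_localizable d ll le tau : Prop :=
  forall x : X, exists Omega : set X,
    [/\ d_open d Omega, Omega x & localizing_nbhd d ll le tau Omega].

Definition SR_localizable d ll le tau : Prop :=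
  forall (x : X) (U : set X), d_open d U -> U x ->
    exists Omega : set X,
      [/\ d_open d Omega, Omega x, Omega `<=` U &
          localizing_nbhd d ll le tau Omega].

End Lorentzian.

(* Main.v *)
Require Import Defs.
From HB Require Import structures.
From mathcomp Require Import all_boot all_order all_algebra.
From mathcomp Require Import boolp classical_sets reals constructive_ereal ereal.
From mathcomp Require Import lra.
Import Order.TTheory GRing.Theory Num.Theory.
Local Open Scope classical_set_scope.
Local Open Scope ring_scope.
Set Implicit Arguments. Unset Strict Implicit. Unset Printing Implicit Defensive.

(** Since the length is additive, a causal curve of positive length has a short
    piece of positive length inside a localizing neighbourhood; the endpoints of
    that piece are chronologically related, so the local maximizer joining them
    is timelike and at least as long.  Starting from it, the rest of the curve is
    absorbed little by little on both sides: if a timelike curve ends where a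
    short causal piece begins, push-up makes a late point of the former
    chronologically related to the end of the latter, and the local maximizer
    between these two points replaces everything in between.  No length is ever
    lost, and length is gained strictly when the absorbed piece contains a null
    segment.  All replacements take place in the chosen localizing
    neighbourhoods, which in the SR case may be taken inside any neighbourhood of
    the curve. *)

(** * Interval induction *)

(** Compactness of [[a, b]]: the local hypothesis at the supremum of the [t] with [P a t] carries
    [P a] past this supremum unless [b] is reached. Trivial intervals are allowed in the local
    hypothesis, which supplies the base case [P a a]. *)
Lemma interval_induction (R : realType) (P : R -> R -> Prop) (a b : R) :
  a <= b ->
  (forall s t u, a <= s -> s <= t -> t <= u -> u <= b -> P s t -> P t u -> P s u) ->
  (forall t, itv a b t -> exists2 dl : R, 0 < dl &
     forall s u, a <= s -> s <= u -> u <= b -> t - dl < s -> u < t + dl -> P s u) ->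
  P a b.
Proof.
move=> ab Ptrans Ploc.
pose S : set R := [set t | itv a b t /\ P a t].
have Sa : S a.
  have [dl dl0 H] := Ploc a (conj (lexx a) ab).
  by split; [split|apply: H => //; lra].
have ubS : has_ubound S by exists b => t [[]].
have hsS : has_sup S by split; [exists a|].
have am : a <= sup S by exact: ub_le_sup.
have mb : sup S <= b by apply: ge_sup => //; [exists a | move=> t [[]]].
have [dl dl0 H] := Ploc _ (conj am mb).
(* [x] belongs to [S] and lies within [dl] of the supremum, so the local hypothesis links it to
   points slightly beyond. *)
have [x [[ax xb] Pax] mx] := sup_adherent dl0 hsS.
have xm : x <= sup S by apply: ub_le_sup.
have P' y : x <= y -> y <= b -> y < sup S + dl -> P a y.
  move=> xy yb ym; apply: (Ptrans a x y) => //.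
  by apply: H => //; lra.
have [bm|mb'] := ltP b (sup S + dl); first exact: P'.
suff : sup S + dl / 2 <= sup S by lra.
apply: ub_le_sup => //; split; first by split; lra.
by apply: P'; lra.
Qed.

(** * Additivity of the length *)

Section Length.
Variables (R : realType) (X : Type) (tau : X -> X -> \bar R).
Implicit Types (g h : R -> X) (s t u m k : R) (x y z : \bar R).

(** Partitions grown at their right end replace index functions, so that shifting, concatenating and
    splitting become inductions. *)
Inductive partition_sum g s : R -> \bar R -> Prop :=
| partition_sum1 u : s < u -> partition_sum g s u (tau (g s) (g u))
| partition_sumS t u x : partition_sum g s t x -> t < u ->
    partition_sum g s u (x + tau (g t) (g u))%E.

Lemma partition_sum_lt g s u x : partition_sum g s u x -> s < u.
Proof. by elim=> // t v y _ st tv; apply: lt_trans tv. Qed.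

Lemma partition_sum_of_partition g N (t : nat -> R) :
  (forall i, (i < N.+1)%N -> t i < t i.+1) ->
  partition_sum g (t 0%N) (t N.+1)
    (\sum_(i < N.+1) tau (g (t i)) (g (t i.+1)))%E.
Proof.
elim: N => [|N IH] tinc.
  by rewrite big_ord_recr big_ord0 /= add0e; apply: partition_sum1; apply: tinc.
rewrite big_ord_recr /=; apply: partition_sumS; last exact: tinc.
by apply: IH => i iN; apply: tinc; rewrite ltnW.
Qed.

Lemma partition_of_partition_sum g s u x : partition_sum g s u x ->
  exists N (t : nat -> R), Defs.partition s u N t /\
    x = (\sum_(i < N) tau (g (t i)) (g (t i.+1)))%E.
Proof.
elim=> [v sv|t v y _ [N [p [[N0 p0 pN pinc] ->]]] tv].
  exists 1%N, (fun i => if i is 0%N then s else v); split; first by split=> // -[].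
  by rewrite big_ord_recr big_ord0 /= add0e.
(* Only the indices up to [N.+1] matter; beyond them the function stays at [v]. *)
exists N.+1, (fun i => if (i <= N)%N then p i else v); split.
  split=> //; rewrite /= ?leq0n ?ltnn // => i.
  rewrite ltnS => iN; rewrite iN; case: ltnP iN => [iN _|Ni iN]; first exact: pinc.
  by have -> : i = N; [apply/eqP; rewrite eqn_leq iN|rewrite pN].
rewrite big_ord_recr /= leqnn ltnn pN; congr (_ + _)%E.
by apply: eq_bigr => i _; rewrite ltn_ord ltnW.
Qed.

Lemma LtauE g s u : Ltau tau g s u = ereal_inf [set x | partition_sum g s u x].
Proof.
congr ereal_inf; apply/seteqP; split=> x /=.
  by move=> [[|N] [t [[// _ <- <- tinc] ->]]]; apply: partition_sum_of_partition.
exact: partition_of_partition_sum.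
Qed.

Lemma partition_sum_ext g h s u x : (forall t, itv s u t -> g t = h t) ->
  partition_sum g s u x -> partition_sum h s u x.
Proof.
move=> gh px; elim: px gh => [v sv|t v y pst IH tv] gh.
  rewrite (gh s) ?(gh v); first exact: partition_sum1; split; lra.
have st := partition_sum_lt pst.
rewrite (gh t) ?(gh v); [|split; lra|split; lra].
apply: partition_sumS => //; apply: IH => r [sr rt]; apply: gh; split; lra.
Qed.

Lemma Ltau_ext g h s u : (forall t, itv s u t -> g t = h t) ->
  Ltau tau g s u = Ltau tau h s u.
Proof.
move=> gh; rewrite !LtauE; congr ereal_inf; apply/seteqP; split=> x /=;
  by apply: partition_sum_ext => t /gh.
Qed.

Lemma partition_sum_shift g k s u x : partition_sum g s u x ->
  partition_sum (fun t => g (t + k)) (s - k) (u - k) x.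
Proof.
elim=> [v sv|t v y _ IH tv].
  have := @partition_sum1 (fun t => g (t + k)) (s - k) (v - k).
  by rewrite !subrK; apply; lra.
have := @partition_sumS (fun t => g (t + k)) _ _ (v - k) _ IH.
by rewrite !subrK; apply; lra.
Qed.

Lemma Ltau_shift g k s u :
  Ltau tau (fun t => g (t + k)) (s - k) (u - k) = Ltau tau g s u.
Proof.
rewrite !LtauE; congr ereal_inf; apply/seteqP; split=> x /=; last first.
  exact: partition_sum_shift.
move=> /(@partition_sum_shift _ (- k)); rewrite !opprK !subrK.
by apply: partition_sum_ext => t _; rewrite subrK.
Qed.

Lemma partition_sum_cat g s t u x y : partition_sum g s t x ->
  partition_sum g t u y -> partition_sum g s u (x + y)%E.
Proof.
move=> px; elim=> [v tv|r v z _ IH rv]; first exact: partition_sumS.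
by rewrite addeA; apply: partition_sumS.
Qed.

Hypothesis tau_ge0 : forall p q, (0 <= tau p q)%E.

Lemma partition_sum_ge0 g s u x : partition_sum g s u x -> (0 <= x)%E.
Proof. by elim=> // t v y _ y0 _; apply: adde_ge0. Qed.

Lemma Ltau_ge0 g s u : (0 <= Ltau tau g s u)%E.
Proof. by rewrite LtauE; apply: le_ereal_inf_tmp => x /partition_sum_ge0. Qed.

Lemma Ltau_le_tau g s u : s < u -> (Ltau tau g s u <= tau (g s) (g u))%E.
Proof. by move=> su; rewrite LtauE; apply: ereal_inf_lbound; apply: partition_sum1. Qed.

(** Concatenate partitions that are optimal up to [e / 2]. Choosing them requires finite infima, so
    the value [+oo] is treated first. *)
Lemma Ltau_le_cat g s t u : s < t -> t < u ->
  (Ltau tau g s u <= Ltau tau g s t + Ltau tau g t u)%E.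
Proof.
move=> st tu.
have H1 := Ltau_ge0 g s t; have H2 := Ltau_ge0 g t u.
have [/eqP E1|F1] := boolP (Ltau tau g s t == +oo%E).
  by rewrite E1 addye ?leey // gt_eqF // (lt_le_trans _ H2) // ltNy0.
have [/eqP E2|F2] := boolP (Ltau tau g t u == +oo%E).
  by rewrite E2 addey ?leey // gt_eqF // (lt_le_trans _ H1) // ltNy0.
have {}F1 : Ltau tau g s t \is a fin_num by rewrite ge0_fin_numE // ltey.
have {}F2 : Ltau tau g t u \is a fin_num by rewrite ge0_fin_numE // ltey.
apply/lee_addgt0Pr => e e0.
have e2 : 0 < e / 2 by lra.
move: F1 F2; rewrite !LtauE => F1 F2.
have [x px xe] := lb_ereal_inf_adherent e2 F1.
have [y py ye] := lb_ereal_inf_adherent e2 F2.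
apply: (@le_trans _ _ (x + y)%E).
  by apply: ereal_inf_lbound; apply: partition_sum_cat px py.
apply: le_trans (leeD (ltW xe) (ltW ye)) _.
rewrite addeACA -EFinD; have -> : e / 2 + e / 2 = e by lra.
exact: lexx.
Qed.

Variable le : X -> X -> Prop.
Hypothesis tau_tri : forall p q r, le p q -> le q r ->
  (tau p q + tau q r <= tau p r)%E.

Definition increasing_on (r : X -> X -> Prop) g s u :=
  forall t t', itv s u t -> itv s u t' -> t < t' -> r (g t) (g t').

(** Inserting [m] into a partition can only lower its sum, by the reverse triangle inequality. This
    is the harder half of additivity. *)
Lemma partition_sum_split g s m u x : increasing_on le g s u ->
  s < m -> m < u -> partition_sum g s u x ->
  exists y z, [/\ partition_sum g s m y, partition_sum g m u z & (y + z <= x)%E].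
Proof.
move=> + sm + px; elim: px => [v sv|t v w pst IH tv] ginc mv.
  exists (tau (g s) (g m)), (tau (g m) (g v)).
  split; [exact: partition_sum1|exact: partition_sum1|].
  by apply: tau_tri; apply: ginc => //; split; lra.
have st := partition_sum_lt pst.
have [mt|tm|mt] := ltgtP m t.
- have ginct : increasing_on le g s t.
    by move=> r r' [? ?] [? ?] rr'; apply: ginc => //; split; lra.
  have [y [z [py pz yz]]] := IH ginct mt.
  exists y, (z + tau (g t) (g v))%E; split=> //; first exact: partition_sumS.
  by rewrite addeA leeD2r.
- exists (w + tau (g t) (g m))%E, (tau (g m) (g v)).
  split; [exact: partition_sumS|exact: partition_sum1|].
  by rewrite -addeA leeD2l // tau_tri //; apply: ginc => //; split; lra.
- by rewrite mt; exists w, (tau (g t) (g v)); split=> //; apply: partition_sum1.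
Qed.

Lemma Ltau_cat g s t u : increasing_on le g s u -> s < t -> t < u ->
  Ltau tau g s u = (Ltau tau g s t + Ltau tau g t u)%E.
Proof.
move=> ginc st tu; apply/eqP; rewrite eq_le Ltau_le_cat //= !LtauE.
apply: le_ereal_inf_tmp => x px.
have [y [z [py pz yz]]] := partition_sum_split ginc st tu px.
by apply: le_trans yz; apply: leeD; apply: ereal_inf_lbound.
Qed.

(* [Ltau] is [+oo] on a trivial interval, which has no partition. *)
Definition len g s u : \bar R := if s < u then Ltau tau g s u else 0%E.

Lemma len_ge0 g s u : (0 <= len g s u)%E.
Proof. by rewrite /len; case: ifP => // _; apply: Ltau_ge0. Qed.

Lemma len_cat g s t u : increasing_on le g s u -> s <= t -> t <= u ->
  len g s u = (len g s t + len g t u)%E.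
Proof.
move=> ginc; rewrite le_eqVlt => /orP[/eqP <-|st].
  by rewrite {2}/len ltxx add0e.
rewrite le_eqVlt => /orP[/eqP <-|tu]; first by rewrite {3}/len ltxx adde0.
by rewrite /len st tu (lt_trans st tu); apply: Ltau_cat.
Qed.

End Length.

(** * Lipschitz paths *)

Section Paths.
Variables (R : realType) (X : Type) (d : X -> X -> R).
Hypothesis Hd : is_metric d.
Implicit Types (g h : R -> X) (s t u m k : R) (U : set X) (r : X -> X -> Prop).

Definition lipschitz_on g s u := exists2 L : R, 0 <= L &
  forall t t', itv s u t -> itv s u t' -> d (g t) (g t') <= L * `|t - t'|.

Lemma lipschitz_on_cat g s m u : s <= m -> m <= u ->
  lipschitz_on g s m -> lipschitz_on g m u -> lipschitz_on g s u.
Proof.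
case: Hd => _ _ dC dtri sm mu [L L0 H] [L' L'0 H'].
(* The sum serves as a common bound for both nonnegative constants. *)
exists (L + L'); first exact: addr_ge0.
have mono (A B x : R) : 0 <= x -> 0 <= B -> A * x <= (A + B) * x.
  by move=> x0 B0; apply: ler_wpM2r => //; lra.
have cross t t' : itv s m t -> itv m u t' ->
    d (g t) (g t') <= (L + L') * `|t - t'|.
  move=> [st tm] [mt' t'u]; apply: le_trans (dtri _ (g m) _) _.
  have -> : `|t - t'| = `|t - m| + `|m - t'|.
    by rewrite !ler0_norm ?subr_le0 //; lra.
  rewrite mulrDr; apply: lerD.
    by apply: le_trans (mono _ L' _ _ _) => //; apply: H; split; lra.
  rewrite addrC; apply: le_trans (mono _ L _ _ _) => //.
  by apply: H'; split; lra.
move=> t t' [st tu] [st' t'u].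
have [tm|mt] := leP t m; have [t'm|mt'] := leP t' m.
- by apply: le_trans (mono _ L' _ _ _) => //; apply: H.
- by apply: cross; split; lra.
- by rewrite dC distrC; apply: cross; split; lra.
- rewrite addrC; apply: le_trans (mono _ L _ _ _) => //.
  by apply: H'; split; lra.
Qed.

Lemma lipschitz_on_sub g s u s' u' : s <= s' -> u' <= u ->
  lipschitz_on g s u -> lipschitz_on g s' u'.
Proof.
move=> ss' u'u [L L0 H]; exists L => // t t' [? ?] [? ?].
by apply: H; split; lra.
Qed.

(** On a compact interval the local constants combine into a global one, which is easier to restrict
    and glue. *)
Lemma loc_lipschitzP g s u : s <= u ->
  loc_lipschitz d g s u <-> lipschitz_on g s u.
Proof.
move=> su; split=> [H|[L L0 H] t _]; last first.
  by exists 1; [exact: ltr01|exists L => ? ? ? ? _ _; exact: H].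
apply: (interval_induction su) => [t m v _ tm mv _|t /H [e e0 [L HL]]].
  exact: lipschitz_on_cat.
(* The local constant carries no sign, hence the absolute value. *)
exists e => // x y sx xy yu tx yt; exists `|L| => // z z' [xz zy] [xz' z'y].
apply: le_trans (HL z z' _ _ _ _) _.
- by split; lra.
- by split; lra.
- by rewrite ltr_norml; apply/andP; split; lra.
- by rewrite ltr_norml; apply/andP; split; lra.
- by apply: ler_wpM2r => //; apply: ler_norm.
Qed.

Lemma lipschitz_on_open g s u (W : set X) t : d_open d W ->
  lipschitz_on g s u -> itv s u t -> W (g t) ->
  exists2 dl : R, 0 < dl & forall t', itv s u t' -> `|t - t'| < dl -> W (g t').
Proof.
move=> Wo [L L0 H] st /Wo [e e0 He].
(* Adding 1 makes the divisor positive even when [L = 0]. *)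
have L1 : 0 < L + 1 by lra.
exists (e / (L + 1)); first exact: divr_gt0.
move=> t' st' tt'; apply: He; apply: le_lt_trans (H _ _ st st') _.
apply: (@le_lt_trans _ _ ((L + 1) * `|t - t'|)).
  by apply: ler_wpM2r => //; lra.
by rewrite mulrC -ltr_pdivlMr.
Qed.

(** Non-constancy and [s < u] are left out, so that every restriction of a path is again a path. The
    relation [r] is [le] or [ll]. *)
Definition path_in r U g s u :=
  [/\ lipschitz_on g s u, increasing_on r g s u & curve_in U g s u].

Lemma path_in_sub r U g s u s' u' : s <= s' -> u' <= u ->
  path_in r U g s u -> path_in r U g s' u'.
Proof.
move=> ss' u'u [gL ginc gU]; split; first exact: lipschitz_on_sub gL.
  by move=> t t' [? ?] [? ?]; apply: ginc; split; lra.
by move=> t [? ?]; apply: gU; split; lra.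
Qed.

Lemma path_in_subset r U V g s u : U `<=` V ->
  path_in r U g s u -> path_in r V g s u.
Proof. by move=> UV [gL ginc gU]; split=> // t /gU /UV. Qed.

Lemma path_in_shift r U g k s u : path_in r U g (s + k) (u + k) ->
  path_in r U (fun t => g (t + k)) s u.
Proof.
move=> [[L L0 H] ginc gU]; split.
- exists L => // t t' [? ?] [? ?].
  have -> : t - t' = (t + k) - (t' + k) by lra.
  by apply: H; split; lra.
- by move=> t t' [? ?] [? ?] tt'; apply: ginc; [split; lra..|lra].
- by move=> t [? ?]; apply: gU; split; lra.
Qed.

Definition glue g h m t : X := if t <= m then g t else h t.

Lemma glueL g h m t : t <= m -> glue g h m t = g t.
Proof. by rewrite /glue => ->. Qed.

Lemma glueR g h m t : g m = h m -> m <= t -> glue g h m t = h t.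
Proof.
rewrite /glue => gh mt; case: ifP => // tm.
by have -> : t = m by apply/eqP; rewrite eq_le mt tm.
Qed.

Lemma path_in_glue r U g h s m u : (forall x y z, r x y -> r y z -> r x z) ->
  s <= m -> m <= u -> g m = h m -> path_in r U g s m -> path_in r U h m u ->
  path_in r U (glue g h m) s u.
Proof.
move=> rtrans sm mu gh [[L L0 H] ginc gU] [[L' L'0 H'] hinc hU].
have EL t : t <= m -> glue g h m t = g t by exact: glueL.
have ER t : m <= t -> glue g h m t = h t by exact: glueR.
split.
- apply: (lipschitz_on_cat sm mu).
    by exists L => // t t' [? ?] [? ?]; rewrite !EL //; apply: H.
  by exists L' => // t t' [? ?] [? ?]; rewrite !ER //; apply: H'.
- move=> t t' [? ?] [? ?] tt'.
  have [t'm|mt'] := leP t' m.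
    by rewrite (EL t) 1?(EL t'); [apply: ginc => //; split; lra|lra..].
  have [mt|tm] := leP m t.
    by rewrite (ER t) 1?(ER t'); [apply: hinc => //; split; lra|lra..].
  rewrite (EL t) 1?(ER t'); [|lra..].
  (* Points on opposite sides of [m] are compared through the common point. *)
  apply: (rtrans _ (g m)); first by apply: ginc => //; split; lra.
  by rewrite gh; apply: hinc => //; split; lra.
- move=> t [? ?]; have [tm|mt] := leP t m.
    by rewrite EL //; apply: gU.
  by rewrite ER; [apply: hU; split; lra|lra].
Qed.

(** * Null segments under change and splitting of the interval *)

Section NullSegments.
Variables ll le : X -> X -> Prop.
Local Notation has_null := (has_null_segment d ll le).

Lemma has_null_segment_ext g h s u s' u' : s' <= s -> u <= u' ->
  (forall t, itv s u t -> g t = h t) -> has_null g s u -> has_null h s' u'.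
Proof.
move=> s's uu' gh [c [e [sc ce eu [[_ gL [x [y [cx cy xy]]] ginc] gnull]]]].
have E t : itv c e t -> g t = h t by move=> [? ?]; apply: gh; split; lra.
exists c, e; split=> //; [lra|lra|split; first split=> //].
- move=> t /gL [dl dl0 [L H]]; exists dl => //; exists L => z z' cz cz'.
  by rewrite -!E //; apply: H.
- by exists x, y; rewrite -!E.
- by move=> z z' cz cz'; rewrite -!E //; apply: ginc.
- by move=> z z' cz cz'; rewrite -!E //; apply: gnull.
Qed.

Lemma has_null_segment_refl g s : ~ has_null g s s.
Proof. by move=> [c [e [? ? ? _]]]; lra. Qed.

(** When [t] cuts the null segment, one half might be constant. But [g] differs from [g t] somewhere
    on the segment, and the half containing such a point is non-constant, hence a null segment. *)
Lemma has_null_segment_split g s t u : has_null g s u ->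
  has_null g s t \/ has_null g t u.
Proof.
move=> [c [e [sc ce eu Hn]]].
have [tc|ct] := leP t c; first by right; exists c, e.
have [et|te] := leP e t; first by left; exists c, e.
have [[_ /loc_lipschitzP gL [x [y [cx cy xy]]] ginc] gnull] := Hn.
have sub c' e' z : c <= c' -> c' < e' -> e' <= e -> itv c' e' z ->
    itv c' e' t -> g z <> g t -> null_segment d ll le g c' e'.
  move=> cc' ce' ee' cz ct' gzt; split; first split=> //.
  - by apply/loc_lipschitzP; [exact: ltW|apply: lipschitz_on_sub (gL (ltW ce))].
  - by exists z, t.
  - by move=> ? ? [? ?] [? ?]; apply: ginc; split; lra.
  - by move=> ? ? [? ?] [? ?]; apply: gnull; split; lra.
suff [z [[cz ze] gzt]] : exists z, itv c e z /\ g z <> g t.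
  have [zt|tz] := leP z t.
    by left; exists c, t; split=> //; apply: (sub _ _ z) => //; try split; lra.
  by right; exists t, e; split=> //; apply: (sub _ _ z) => //; try split; lra.
have [gxt|gxt] := pselect (g x = g t); last by exists x.
by exists y; split=> // gyt; apply: xy; rewrite gxt gyt.
Qed.

End NullSegments.

End Paths.

(** * Inequalities that are strict under a condition *)

(** Both claims about lengths travel together: none is lost, and some is gained if [P], the presence
    of a null segment, holds. *)
Definition le_lt_if (R : realType) (P : Prop) (x y : \bar R) : Prop :=
  (x <= y)%E /\ (P -> (x < y)%E).

Section LeLtIf.
Variable R : realType.
Implicit Types (P Q S : Prop) (x y z w v : \bar R).

Lemma le_lt_if_imply P Q x y : (Q -> P) -> le_lt_if P x y -> le_lt_if Q x y.
Proof. by move=> QP [xy lxy]; split=> // /QP. Qed.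

Lemma le_lt_if_trans P Q x y z :
  le_lt_if P x y -> le_lt_if Q y z -> le_lt_if (P \/ Q) x z.
Proof.
move=> [xy lxy] [yz lyz]; split; first exact: le_trans yz.
by move=> [/lxy h|/lyz h]; [apply: lt_le_trans yz|apply: le_lt_trans h].
Qed.

Lemma le_lt_if_addl P z x y : z \is a fin_num ->
  le_lt_if P x y -> le_lt_if P (z + x)%E (z + y)%E.
Proof. by move=> zf [xy lxy]; split; [rewrite leeD2l|rewrite lteD2lE]. Qed.

(** Bookkeeping for two successive absorptions: a curve of length [x] absorbs pieces of lengths [y]
    and [z], reaching lengths [w] and then [v]. Finiteness of [z] lets a strict gain in the first
    step survive the addition of [z]. *)
Lemma le_lt_if_chain P Q S x y z w v : (S -> P \/ Q) ->
  z \is a fin_num -> le_lt_if P (x + y)%E w -> le_lt_if Q (w + z)%E v ->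
  le_lt_if S (x + (y + z))%E v.
Proof.
move=> SPQ zf H1 H2; apply: (le_lt_if_imply SPQ); apply: (le_lt_if_trans _ H2).
by rewrite addeA ![(_ + z)%E]addeC; apply: le_lt_if_addl.
Qed.

End LeLtIf.

(** * Absorbing causal paths into timelike curves *)

Section Absorption.
Variables (R : realType) (X : Type) (d : X -> X -> R).
Variables (ll le : X -> X -> Prop) (tau : X -> X -> \bar R).
Hypotheses (Hd : is_metric d) (HL : is_LPLS d ll le tau).
Implicit Types (f g sg : R -> X) (s t u v : R) (U W : set X) (x y p q : X).

Local Notation len := (len tau).
Local Notation path_in := (path_in d).
Local Notation has_null := (has_null_segment d ll le).

Let leX_trans x y z : le x y -> le y z -> le x z.
Proof. by have [_ [H _]] := HL; apply: H. Qed.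

Let ll_trans x y z : ll x y -> ll y z -> ll x z.
Proof. by have [_ [_ [H _]]] := HL; apply: H. Qed.

Let ll_le x y : ll x y -> le x y.
Proof. by have [_ [_ [_ [H _]]]] := HL; apply: H. Qed.

Let tau_ge0 x y : (0 <= tau x y)%E.
Proof. by have [_ [_ [_ [_ [H _]]]]] := HL; apply: H. Qed.

Let tau_tri x y z : le x y -> le y z -> (tau x y + tau y z <= tau x z)%E.
Proof. by have [_ [_ [_ [_ [_ [_ [H _]]]]]]] := HL; apply: H. Qed.

Let tau_gt0 x y : (0 < tau x y)%E <-> ll x y.
Proof. by have [_ [_ [_ [_ [_ [_ [_ [_ H]]]]]]]] := HL; apply: H. Qed.

(** Push-up: [tau x z] is at least [tau x y], which is positive. *)
Lemma ll_le_trans x y z : ll x y -> le y z -> ll x z.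
Proof.
move=> xy yz; apply/tau_gt0; apply: lt_le_trans (tau_tri (ll_le xy) yz).
by move/tau_gt0: xy => xy; apply: lt_le_trans xy _; rewrite leeDl.
Qed.

Lemma le_ll_trans x y z : le x y -> ll y z -> ll x z.
Proof.
move=> xy yz; apply/tau_gt0; apply: lt_le_trans (tau_tri xy (ll_le yz)).
by move/tau_gt0: yz => yz; apply: lt_le_trans yz _; rewrite leeDr.
Qed.

Lemma path_in_ll_le U g s u : path_in ll U g s u -> path_in le U g s u.
Proof.
by move=> [gL ginc gU]; split=> // t t' st st' tt'; apply/ll_le/ginc.
Qed.

Lemma len_pathD U g s t u : path_in le U g s u -> s <= t -> t <= u ->
  len g s u = (len g s t + len g t u)%E.
Proof. by move=> [_ ginc _]; apply: len_cat tau_tri _ _ _ _ ginc. Qed.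

Lemma len_ext f g s u : (forall t, itv s u t -> f t = g t) ->
  len f s u = len g s u.
Proof. by move=> fg; rewrite /len; case: ifP => // _; apply: Ltau_ext. Qed.

Lemma len_glue U f g s t u : path_in le U f s t -> path_in le U g t u ->
  f t = g t -> s <= t -> t <= u ->
  len (glue f g t) s u = (len f s t + len g t u)%E.
Proof.
move=> pf pg fg st tu.
rewrite (len_pathD (path_in_glue Hd leX_trans st tu fg pf pg) st tu).
congr (_ + _)%E; apply: len_ext => v [? ?]; first exact: glueL.
exact: glueR.
Qed.

(* Were [ll x x], the finite number [omega x x] would be positive and at least
   twice itself. *)
Lemma ll_irr W x : localizing_nbhd d ll le tau W -> W x -> ~ ll x x.
Proof.
move=> [_ [om [_ _ Hom _ _]]] Wx xx.
have [om_refl [_ [_ [_ [_ [_ [om_tri [_ om_gt0]]]]]]]] := Hom.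
move/(om_gt0 _ _ Wx Wx): (xx); rewrite lte_fin => om0.
have := om_tri x x x Wx Wx Wx (om_refl x Wx) (om_refl x Wx).
by rewrite -EFinD lee_fin; lra.
Qed.

(** Non-constancy is not recorded; irreflexivity of [ll] restores it at the end. *)
Definition timelike_from_to U g s u p q :=
  [/\ s < u, path_in ll U g s u, g s = p & g u = q].

(** Local maximizers come with arbitrary parameter intervals; translation aligns them for gluing
    without changing the length. *)
Lemma timelike_shift U g s u p q k : timelike_from_to U g s u p q ->
  exists2 g', timelike_from_to U g' (s - k) (u - k) p q &
    len g' (s - k) (u - k) = len g s u.
Proof.
move=> [su pg gs gu]; exists (fun t => g (t + k)).
  by split; rewrite ?subrK //; [lra|apply: path_in_shift; rewrite !subrK].
rewrite /len; have -> : s - k < u - k by lra.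
by rewrite su Ltau_shift.
Qed.

Lemma timelike_start v U g s u p q : timelike_from_to U g s u p q ->
  exists g' u', timelike_from_to U g' v u' p q /\ len g' v u' = len g s u.
Proof.
move=> /(timelike_shift (s - v)); have -> : s - (s - v) = v by lra.
by move=> [g' ? ?]; exists g', (u - (s - v)).
Qed.

Lemma timelike_end v U g s u p q : timelike_from_to U g s u p q ->
  exists g' s', timelike_from_to U g' s' v p q /\ len g' s' v = len g s u.
Proof.
move=> /(timelike_shift (u - v)); have -> : u - (u - v) = v by lra.
by move=> [g' ? ?]; exists g', (s - (u - v)).
Qed.

(** Irreflexivity makes the endpoints distinct, so the local maximizer exists. The curve [f] is one
    of its competitors, and a null segment in [f] makes the comparison strict. *)
Lemma local_maximizer W f s u : localizing_nbhd d ll le tau W ->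
  s < u -> path_in le W f s u -> ll (f s) (f u) ->
  exists g s' u', timelike_from_to W g s' u' (f s) (f u) /\
    le_lt_if (has_null f s u) (len f s u) (len g s' u').
Proof.
move=> HW su [fL finc fW] fsu.
have Ws : W (f s) by apply: fW; split=> //; exact: ltW.
have Wu : W (f u) by apply: fW; split=> //; exact: ltW.
have fne : f s <> f u by move=> E; move: fsu; rewrite E; apply: ll_irr Wu.
have fc : fd_causal d le f s u.
  split=> //; first by apply/loc_lipschitzP => //; exact: ltW.
  by exists s, u; split=> //; split=> //; exact: ltW.
have [_ [om [_ _ _ _ Hmax]]] := HW.
have [g [s' [u' [_ [gs [gu [gW [gmax [_ [_ /(_ fsu) [[su' gL _ ginc] gstrict]]]]]]]]]]] :=
  Hmax _ _ Ws Wu (ll_le fsu) fne.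
exists g, s', u'; split.
  by split=> //; split=> //; apply/loc_lipschitzP => //; exact: ltW.
rewrite /len su su'; split; first exact: gmax.
by move=> fn; apply: gstrict.
Qed.

(** * Absorption within a region covered by localizing neighbourhoods *)

Variable U : set X.
(** One hypothesis for both cases: [U] is the whole space, or an open neighbourhood of the curve
    when the space is SR-localizable. *)
Hypothesis HU : forall x, U x -> exists W : set X,
  [/\ d_open d W, W x, W `<=` U & localizing_nbhd d ll le tau W].

(** This provides the local step of every interval induction along a path. *)
Lemma path_in_local_nbhd f s u t : path_in le U f s u -> itv s u t ->
  exists2 dl : R, 0 < dl & exists W, [/\ d_open d W, W `<=` U,
    localizing_nbhd d ll le tau W &
    forall t1 t2, s <= t1 -> t1 <= t2 -> t2 <= u -> t - dl < t1 -> t2 < t + dl ->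
      path_in le W f t1 t2].
Proof.
move=> pf st; have [fL _ fU] := pf.
have [W [Wo Wt WU HW]] := HU (fU _ st).
have [dl dl0 H] := lipschitz_on_open Wo fL st Wt.
exists dl => //; exists W; split=> // t1 t2 st1 t12 t2u tt1 tt2.
have [fL' finc' _] := path_in_sub st1 t2u pf.
split=> // v [t1v vt2]; apply: H; first by split; lra.
by rewrite ltr_norml; apply/andP; split; lra.
Qed.

(** Locally the length is bounded by that of a maximizer, which is a value of the real function
    [omega]; additivity does the rest. *)
Lemma len_fin_num f s u : s <= u -> path_in le U f s u -> len f s u \is a fin_num.
Proof.
move=> su pf.
apply: (interval_induction su (P := fun s u => len f s u \is a fin_num)).
  move=> t v w st tv vw wu F1 F2.
  rewrite (len_pathD (path_in_sub st wu pf) tv vw).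
  by rewrite fin_numD F1.
move=> t st; have [dl dl0 [W [_ _ HW H]]] := path_in_local_nbhd pf st.
exists dl => // t1 t2 st1 t12 t2u tt1 tt2.
have [fL finc fW] := H _ _ st1 t12 t2u tt1 tt2.
rewrite ge0_fin_numE; last exact: len_ge0.
rewrite /len; case: ifP => [lt12|_]; last exact: ltry.
have W1 : W (f t1) by apply: fW.
have W2 : W (f t2) by apply: fW.
(* Without distinct endpoints there is no maximizer, but then [tau] vanishes by irreflexivity and
   bounds the length. *)
have [E|ne] := pselect (f t1 = f t2).
  apply: le_lt_trans (Ltau_le_tau _ _ lt12) _.
  rewrite -E; have /negP : ~ (0 < tau (f t1) (f t1))%E.
    by move/tau_gt0; apply: ll_irr W1.
  by rewrite -leNgt => t0; apply: le_lt_trans t0 _; exact: ltry.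
have [_ [om [_ _ _ _ Hmax]]] := HW.
have le12 : le (f t1) (f t2) by apply: finc.
have [g [s' [u' [_ [_ [_ [_ [gmax [gom _]]]]]]]]] := Hmax _ _ W1 W2 le12 ne.
apply: le_lt_trans (gmax f t1 t2 _ _ _ fW) _ => //; last by rewrite gom ltry.
split=> //; first exact/(loc_lipschitzP Hd).
by exists t1, t2; split.
Qed.

(** Step back along the timelike curve to a point [v] from which it stays in [W]. By push-up this
    point is chronologically before [f u], so the local maximizer can replace the concatenation [k]
    from [v] to [u]. *)
Lemma absorb_right_local W f s u sg al be p :
  d_open d W -> W `<=` U -> localizing_nbhd d ll le tau W ->
  s < u -> path_in le W f s u -> timelike_from_to U sg al be p (f s) ->
  exists sg' al' be', timelike_from_to U sg' al' be' p (f u) /\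
    le_lt_if (has_null f s u) (len sg al be + len f s u)%E (len sg' al' be').
Proof.
move=> Wo WU HW su pf /(timelike_end s) [{be}sg0 [al0 [[als psg sgal sgs] <-]]].
have [fL finc fW] := pf; have psg' := path_in_ll_le psg; have [sgL sginc sgU] := psg.
have Ws : W (sg0 s) by rewrite sgs; apply: fW; split=> //; exact: ltW.
have sI : itv al0 s s by split=> //; exact: ltW.
have [dl dl0 Hdl] := lipschitz_on_open Wo sgL sI Ws.
(* Half of [dl] back from [s], or the midpoint of the curve's interval if that would overshoot its
   start. *)
have [v [alv vs dv]] : exists v, [/\ al0 < v, v < s & s - dl < v].
  by have [h|h] := ltP al0 (s - dl / 2); [exists (s - dl / 2)|exists ((al0 + s) / 2)];
    split; lra.
have pv : path_in le W sg0 v s.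
  have [? ? _] := path_in_sub (ltW alv) (lexx s) psg'; split=> // t [? ?].
  by apply: Hdl; [split; lra|rewrite ltr_norml; apply/andP; split; lra].
pose k := glue sg0 f s.
have pk : path_in le W k v u by apply: path_in_glue => //; exact: ltW.
have kv : k v = sg0 v by apply: glueL; exact: ltW.
have ku : k u = f u by apply: glueR => //; exact: ltW.
have kvu : ll (k v) (k u).
  rewrite kv ku; apply: (@ll_le_trans _ (f s)).
    by rewrite -sgs; apply: sginc => //; split=> //; exact: ltW.
  by apply: finc => //; split=> //; exact: ltW.
have [g0 [s' [u' [/(timelike_start v) [g [be [[vbe pg gv gbe] <-]]] Hlen]]]] :=
  local_maximizer HW (lt_trans vs su) pk kvu.
have gsg : sg0 v = g v by rewrite gv kv.
have pg' := path_in_subset WU pg.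
have psgv := path_in_sub (lexx al0) (ltW vs) psg.
exists (glue sg0 g v), al0, be; split.
  split; first exact: lt_trans vbe.
  - by apply: path_in_glue => //; exact: ltW.
  - by rewrite glueL //; exact: ltW.
  - by rewrite glueR // ?gbe //; exact: ltW.
rewrite (len_glue (path_in_ll_le psgv) (path_in_ll_le pg') gsg (ltW alv) (ltW vbe)).
rewrite (len_pathD psg' (ltW alv) (ltW vs)) -addeA.
rewrite -(len_glue pv pf sgs (ltW vs) (ltW su)).
(* The part of the timelike curve before [v] is common to both sides and cancels, being of finite
   length. *)
apply: le_lt_if_addl.
  by apply: len_fin_num; [exact: ltW|exact: path_in_ll_le].
(* [k] agrees with [f] on [[s, u]], so a null segment of [f] is one of [k]. *)
apply: le_lt_if_imply Hlen; apply: has_null_segment_ext => //; first exact: ltW.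
by move=> t [? ?]; rewrite /k glueR.
Qed.

(** Mirror image: [v] is now taken shortly after the start of the timelike curve, and the other
    push-up rule applies. *)
Lemma absorb_left_local W f s u sg al be q :
  d_open d W -> W `<=` U -> localizing_nbhd d ll le tau W ->
  s < u -> path_in le W f s u -> timelike_from_to U sg al be (f u) q ->
  exists sg' al' be', timelike_from_to U sg' al' be' (f s) q /\
    le_lt_if (has_null f s u) (len sg al be + len f s u)%E (len sg' al' be').
Proof.
move=> Wo WU HW su pf /(timelike_start u) [{al}sg0 [be0 [[ube psg sgu sgbe] <-]]].
have [fL finc fW] := pf; have psg' := path_in_ll_le psg; have [sgL sginc sgU] := psg.
have Wu : W (sg0 u) by rewrite sgu; apply: fW; split=> //; exact: ltW.
have uI : itv u be0 u by split=> //; exact: ltW.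
have [dl dl0 Hdl] := lipschitz_on_open Wo sgL uI Wu.
have [v [uv vbe dv]] : exists v, [/\ u < v, v < be0 & v < u + dl].
  by have [h|h] := ltP (u + dl / 2) be0; [exists (u + dl / 2)|exists ((u + be0) / 2)];
    split; lra.
have pv : path_in le W sg0 u v.
  have [? ? _] := path_in_sub (lexx u) (ltW vbe) psg'; split=> // t [? ?].
  by apply: Hdl; [split; lra|rewrite ltr_norml; apply/andP; split; lra].
have fsg : f u = sg0 u by [].
pose k := glue f sg0 u.
have pk : path_in le W k s v by apply: path_in_glue => //; exact: ltW.
have ks : k s = f s by apply: glueL; exact: ltW.
have kv : k v = sg0 v by apply: glueR => //; exact: ltW.
have ksv : ll (k s) (k v).
  rewrite ks kv; apply: (@le_ll_trans _ (f u)).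
    by apply: finc => //; split=> //; exact: ltW.
  by rewrite fsg; apply: sginc => //; split=> //; exact: ltW.
have [g0 [s' [u' [/(timelike_end v) [g [al [[alv pg gal gv] <-]]] Hlen]]]] :=
  local_maximizer HW (lt_trans su uv) pk ksv.
have gsg : g v = sg0 v by rewrite gv kv.
have pg' := path_in_subset WU pg.
have psgv := path_in_sub (ltW uv) (lexx be0) psg.
exists (glue g sg0 v), al, be0; split.
  split; first exact: lt_trans vbe.
  - by apply: path_in_glue => //; exact: ltW.
  - by rewrite glueL ?gal //; exact: ltW.
  - by rewrite glueR //; exact: ltW.
rewrite (len_glue (path_in_ll_le pg') (path_in_ll_le psgv) gsg (ltW alv) (ltW vbe)).
(* The sums are reordered to bring the untouched part after [v] to the front on both sides. *)
rewrite (len_pathD psg' (ltW uv) (ltW vbe)) addeAC [X in le_lt_if _ X]addeC.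
rewrite [X in le_lt_if _ _ X]addeC [X in (_ + X)%E]addeC.
rewrite -(len_glue pf pv fsg (ltW su) (ltW uv)).
apply: le_lt_if_addl.
  by apply: len_fin_num; [exact: ltW|exact: path_in_ll_le].
apply: le_lt_if_imply Hlen; apply: has_null_segment_ext => //; first exact: ltW.
by move=> t [? ?]; rewrite /k glueL.
Qed.

(** Interval induction on a predicate quantified over all timelike curves ending at [f s], so that
    the output of one absorption feeds the next. *)
Lemma absorb_right f s u sg al be p : s <= u -> path_in le U f s u ->
  timelike_from_to U sg al be p (f s) ->
  exists sg' al' be', timelike_from_to U sg' al' be' p (f u) /\
    le_lt_if (has_null f s u) (len sg al be + len f s u)%E (len sg' al' be').
Proof.
move=> su pf; move: sg al be.
apply: (interval_induction su (P := fun s u => forall sg al be,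
  timelike_from_to U sg al be p (f s) ->
  exists sg' al' be', timelike_from_to U sg' al' be' p (f u) /\
    le_lt_if (has_null f s u) (len sg al be + len f s u)%E (len sg' al' be'))).
  move=> t v w st tv vw wu H1 H2 sg al be /H1 [sg1 [al1 [be1 [/H2 + L1]]]].
  move=> [sg2 [al2 [be2 [T2 L2]]]]; exists sg2, al2, be2; split=> //.
  have ptw := path_in_sub st wu pf; rewrite (len_pathD ptw tv vw).
  apply: le_lt_if_chain L1 L2; first exact: has_null_segment_split.
  exact: len_fin_num vw (path_in_sub tv (lexx w) ptw).
move=> t st; have [dl dl0 [W [Wo WU HW H]]] := path_in_local_nbhd pf st.
exists dl => // t1 t2 st1 t12 t2u tt1 tt2 sg al be T.
have pW := H _ _ st1 t12 t2u tt1 tt2.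
move: t12 T; rewrite le_eqVlt => /orP[/eqP E T|lt12 T].
  (* On a trivial interval nothing is absorbed: the length is 0 and there is no null segment. *)
  exists sg, al, be; rewrite -E /len ltxx adde0; split=> //.
  by split=> // /has_null_segment_refl.
exact: absorb_right_local pW T.
Qed.

Lemma absorb_left f s u sg al be q : s <= u -> path_in le U f s u ->
  timelike_from_to U sg al be (f u) q ->
  exists sg' al' be', timelike_from_to U sg' al' be' (f s) q /\
    le_lt_if (has_null f s u) (len sg al be + len f s u)%E (len sg' al' be').
Proof.
move=> su pf; move: sg al be.
apply: (interval_induction su (P := fun s u => forall sg al be,
  timelike_from_to U sg al be (f u) q ->
  exists sg' al' be', timelike_from_to U sg' al' be' (f s) q /\
    le_lt_if (has_null f s u) (len sg al be + len f s u)%E (len sg' al' be'))).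
  (* Absorption now runs backwards: the piece on [[v, w]] comes first. *)
  move=> t v w st tv vw wu H1 H2 sg al be /H2 [sg1 [al1 [be1 [/H1 + L1]]]].
  move=> [sg2 [al2 [be2 [T2 L2]]]]; exists sg2, al2, be2; split=> //.
  have ptw := path_in_sub st wu pf; rewrite (len_pathD ptw tv vw) [X in (_ + X)%E]addeC.
  apply: le_lt_if_chain L1 L2.
    by move=> /(has_null_segment_split Hd v) [|]; [right|left].
  exact: len_fin_num tv (path_in_sub (lexx t) vw ptw).
move=> t st; have [dl dl0 [W [Wo WU HW H]]] := path_in_local_nbhd pf st.
exists dl => // t1 t2 st1 t12 t2u tt1 tt2 sg al be T.
have pW := H _ _ st1 t12 t2u tt1 tt2.
move: t12 T; rewrite le_eqVlt => /orP[/eqP E T|lt12 T].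
  exists sg, al, be; rewrite E /len ltxx adde0; split=> //.
  by split=> // /has_null_segment_refl.
exact: absorb_left_local pW T.
Qed.

(** If all localized pieces had length 0, additivity would propagate this to the whole interval. *)
Lemma local_positive_length f s u : s <= u -> path_in le U f s u ->
  (0 < len f s u)%E ->
  exists t1 t2 W, [/\ s <= t1, t1 < t2, t2 <= u,
    [/\ W `<=` U, localizing_nbhd d ll le tau W & path_in le W f t1 t2] &
    (0 < len f t1 t2)%E].
Proof.
move=> su pf; apply: contraPP => Hno; apply/negP; rewrite -leNgt.
suff -> : len f s u = 0%E by exact: lexx.
apply: (interval_induction su (P := fun s u => len f s u = 0%E)).
  move=> t v w st tv vw wu E1 E2.
  by rewrite (len_pathD (path_in_sub st wu pf) tv vw) E1 E2 adde0.
move=> t st; have [dl dl0 [W [Wo WU HW H]]] := path_in_local_nbhd pf st.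
exists dl => // t1 t2 st1 t12 t2u tt1 tt2.
apply/eqP/negP => /negP ne; apply: Hno; exists t1, t2, W; split=> //.
- by rewrite ltNge; apply/negP => t21; move: ne; rewrite /len ltNge t21 eqxx.
- by split=> //; apply: H.
- by rewrite lt_def ne; apply: len_ge0.
Qed.

(** The maximizer over a localized piece of positive length is the seed; what follows is absorbed on
    the right, then what precedes on the left. *)
Lemma timelike_of_positive_length f s u : s <= u -> path_in le U f s u ->
  (0 < len f s u)%E ->
  exists sg al be, timelike_from_to U sg al be (f s) (f u) /\
    le_lt_if (has_null f s u) (len f s u) (len sg al be).
Proof.
move=> su pf /(local_positive_length su pf).
move=> [t1 [t2 [W [st1 t12 t2u [WU HW pW] pos]]]].
have f12 : ll (f t1) (f t2).
  apply/tau_gt0; apply: lt_le_trans (Ltau_le_tau tau f t12).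
  by move: pos; rewrite /len t12.
have [sg0 [al0 [be0 [[ab0 p0 a0 b0] L0]]]] := local_maximizer HW t12 pW f12.
have T0 : timelike_from_to U sg0 al0 be0 (f t1) (f t2).
  by split=> //; exact: path_in_subset p0.
have p2 := path_in_sub (le_trans st1 (ltW t12)) (lexx u) pf.
have [sg1 [al1 [be1 [T1 L1]]]] := absorb_right t2u p2 T0.
have p1 := path_in_sub (lexx s) (le_trans (ltW t12) t2u) pf.
have [sg2 [al2 [be2 [T2 L2]]]] := absorb_left st1 p1 T1.
exists sg2, al2, be2; split=> //.
have tu := le_trans (ltW t12) t2u.
have pt := path_in_sub st1 (lexx u) pf.
rewrite (len_pathD pf st1 tu) (len_pathD pt (ltW t12) t2u).
(* The added zeros stand for an empty initial curve, which casts the seed as a first absorption in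
   the chain. *)
rewrite addeC -[X in le_lt_if _ X]add0e.
rewrite -[X in le_lt_if _ X _]add0e in L0.
apply: le_lt_if_chain (le_lt_if_chain id _ L0 L1) L2; last 2 first.
- exact: len_fin_num st1 (path_in_sub (lexx s) tu pf).
- exact: len_fin_num t2u p2.
move=> /(has_null_segment_split Hd t1) [|/(has_null_segment_split Hd t2)]; first by right.
by left.
Qed.

Lemma longer_timelike_curve f s u : fd_causal d le f s u -> curve_in U f s u ->
  (0 < Ltau tau f s u)%E -> has_null f s u ->
  exists sg al be,
    [/\ fd_timelike d ll sg al be, sg al = f s, sg be = f u, curve_in U sg al be &
        (Ltau tau f s u < Ltau tau sg al be)%E].
Proof.
move=> [su fL _ finc] fU pos fnull.
have lenE : len f s u = Ltau tau f s u by rewrite /len su.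
have pf : path_in le U f s u by split=> //; apply/loc_lipschitzP => //; exact: ltW.
have := timelike_of_positive_length (ltW su) pf; rewrite lenE => /(_ pos).
move=> [sg [al [be [[ab [sL sinc sU] sal sbe] [_ /(_ fnull)]]]]].
rewrite /len ab => Hlt.
have albe : ll (sg al) (sg be) by apply: sinc => //; split=> //; exact: ltW.
exists sg, al, be; split=> //; split=> //.
  by apply/loc_lipschitzP => //; exact: ltW.
exists al, be; split; [by split=> //; exact: ltW|by split=> //; exact: ltW|].
(* Equal endpoints would be chronologically related to themselves. *)
move=> E; have Ube : U (sg be) by apply: sU; split=> //; exact: ltW.
have [W [_ Wbe _ HW]] := HU Ube.
by move: albe; rewrite E; apply: ll_irr Wbe.
Qed.

End Absorption.

(** * Longer timelike curves, in the whole space and near the given curve *)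

Theorem theorem3p20 (R : realType) (X : Type) (d : X -> X -> R)
  (ll le : X -> X -> Prop) (tau : X -> X -> \bar R)
  (Hd : is_metric d) (HL : is_LPLS d ll le tau)
  (Hloc : regularly_localizable d ll le tau)
  (gamma : R -> X) (a b : R)
  (Hg : fd_causal d le gamma a b)
  (Hpos : (0 < Ltau tau gamma a b)%E)
  (c e : R) (Hc : a <= c) (Hce : c < e) (He : e <= b)
  (Hnull : null_segment d ll le gamma c e) :
  (exists sigma a' b',
     [/\ fd_timelike d ll sigma a' b', sigma a' = gamma a, sigma b' = gamma b &
         (Ltau tau gamma a b < Ltau tau sigma a' b')%E]) /\
  (SR_localizable d ll le tau ->
   forall N : set X, d_nbhd_of_set d (gamma @` [set t | itv a b t]) N ->
   exists sigma a' b',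
     [/\ fd_timelike d ll sigma a' b', sigma a' = gamma a, sigma b' = gamma b,
         curve_in N sigma a' b' &
         (Ltau tau gamma a b < Ltau tau sigma a' b')%E]).
Proof.
have gnull : has_null_segment d ll le gamma a b by exists c, e.
split=> [|HSR N [U [Uo gU UN]]].
  have HT x : [set: X] x -> exists W : set X,
      [/\ d_open d W, W x, W `<=` [set: X] & localizing_nbhd d ll le tau W].
    by move=> _; have [W [Wo Wx HW]] := Hloc x; exists W.
  have gT : curve_in [set: X] gamma a b by [].
  have [sg [al [be [T sal sbe _ Hlt]]]] :=
    longer_timelike_curve Hd HL HT Hg gT Hpos gnull.
  by exists sg, al, be.
have gU' : curve_in U gamma a b by move=> t abt; apply: gU; exists t.
(* SR-localizability covers the open set [U] between the curve and [N] by localizing neighbourhoods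
   inside [U]. *)
have [sg [al [be [T sal sbe sU Hlt]]]] :=
  longer_timelike_curve Hd HL (fun x => HSR x U Uo) Hg gU' Hpos gnull.
by exists sg, al, be; split=> // t /sU /UN.
Qed.
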